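(* Let $1\le m\le n$ be integers and let $E_{m,n}$ be the $m$-th elementary symmetric polynomial in $n$ variables. Then there exists a real number $\alpha'>0$ such that for all real $\alpha\ge\alpha'$ the function $E_{m,n}^{-\alpha}$ is completely monotone on the positive orthant $\mathbb{R}_{>0}^n$.
   Context: $E_{m,n}(x)=\sum_{1\le i_1<\cdots<i_m\le n}x_{i_1}\cdots x_{i_m}$. A real-valued $\mathcal{C}^\infty$ function $f$ on the open positive orthant $\mathbb{R}^n_{>0}$ is called completely monotone if $(-1)^k\frac{\partial^k f}{\partial x_{i_1}\cdots\partial x_{i_k}}(x)\ge 0$ for all $x\in\mathbb{R}^n_{>0}$, all $k\ge 0$ and all indices $1\le i_1\le\cdots\le i_k\le n$. *)

(* Defs.v *)
From HB Require Import structures.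
From mathcomp Require Import all_boot all_order all_algebra.
From mathcomp Require Import all_classical all_reals all_analysis.
(* The notations of mpoly clash with those of MathComp-Analysis. *)
From mathcomp.multinomials Require mpoly.
Import (canonicals) mpoly.

Set Implicit Arguments.
Unset Strict Implicit.
Unset Printing Implicit Defensive.

Import Order.TTheory GRing.Theory Num.Theory.
Import numFieldNormedType.Exports.

Local Open Scope classical_set_scope.
Local Open Scope ring_scope.

Definition pos_orthant (R : realType) (n : nat) : set 'rV[R]_n :=
  [set x | forall i, 0 < x 0 i].

(* E_{m,n}, as a function on R^n *)
Definition elem_sym (R : realType) (m n : nat) (x : 'rV[R]_n) : R :=
  mpoly.meval (fun i => x 0 i) (mpoly.mesym n R m).

Lemma elem_symE (R : realType) (m n : nat) (x : 'rV[R]_n) :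
  elem_sym m x = \sum_(h : {set 'I_n} | #|h| == m) \prod_(i in h) x 0 i.
Proof.
rewrite /elem_sym /mpoly.mesym raddf_sum /=; apply: eq_bigr => h _.
by rewrite rmorph_prod /=; apply: eq_bigr => i _; rewrite mpoly.mevalXU.
Qed.

(* The iterated partial derivative d^k f / dx_{i_1} ... dx_{i_k}, for
   s = [:: i_1; ...; i_k].  'D_v is total, but its value at a point of an open
   set only depends on the function on that set. *)
Definition partials (R : realType) (n : nat) (s : seq 'I_n)
    (f : 'rV[R]_n -> R) : 'rV[R]_n -> R :=
  foldr (fun (i : 'I_n) (g : 'rV[R]_n -> R) => 'D_(delta_mx 0 i) g) f s.

(* C^oo on U (meaningful for open U): the partial derivatives of all orders
   exist and are continuous at every point of U. *)
Definition smooth_on (R : realType) (n : nat) (U : set 'rV[R]_n)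
    (f : 'rV[R]_n -> R) : Prop :=
  forall (s : seq 'I_n) (x : 'rV[R]_n), U x ->
    {for x, continuous (partials s f)} /\
    forall i : 'I_n, derivable (partials s f) x (delta_mx 0 i).

Definition completely_monotone (R : realType) (n : nat)
    (f : 'rV[R]_n -> R) : Prop :=
  smooth_on (@pos_orthant R n) f /\
  forall (s : seq 'I_n) (x : 'rV[R]_n),
    sorted (fun i j : 'I_n => (i <= j)%N) s -> pos_orthant x ->
    0 <= (-1) ^+ size s * partials s f x.

(* Main.v *)
Require Import Defs.
From mathcomp Require Import all_boot all_order all_algebra.
From mathcomp Require Import all_classical all_reals all_analysis.
From mathcomp Require Import measurable_realfun ring lra.

(** Write E_k(S) for the k-th elementary symmetric polynomial in the variables
    x_i with i in S. The induction on m proves more than complete monotonicity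
    of a power of E_m: for |S| >= m, t >= 0 and beta >= n^m, the function

      exp (- t E_(m+1)(S) / E_m(S)) * E_m(S)^(-beta)

    is completely monotone ([cm_elsym_ratio]); t = 0 gives the theorem with
    alpha' = n^m. The ratio E_(m+1) / E_m behaves like the effective
    conductance of a network whose edges have conductances x_i. Put S' = S \ i,
    a = x_i and b = E_m(S') / E_(m-1)(S'). Then E_m(S) = E_(m-1)(S') (a + b),
    and Euler's identity sum_i x_i E_m(S \ i) = (m+1) E_(m+1)(S) becomes

      (m+1) E_(m+1)(S) / E_m(S) = sum_(i in S) a b / (a + b),

    a sum of conductances of two edges in series. So the function above is the
    product over i in S of

      exp (- s a b / (a + b)) * (a + b)^(-gamma) * E_(m-1)(S')^(-gamma),

    with s = t / (m+1) and gamma = beta / |S|. Two integrals write the first two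
    factors as a positive mixture of the exponentials exp (- p a - q b),
    p, q >= 0. Completing the square, the Gaussian integral of
    exp (- u^2 a - (r - u)^2 b) over u is a constant times
    exp (- r^2 a b / (a + b)) * (a + b)^(-1/2) ([integral_two_squares]); this is
    where gamma >= 1/2 is needed. The remaining real power of a + b is a mixture
    of exponentials exp (- w (a + b)) by scaling ([integral_expR_pow]). By the
    induction hypothesis each exp (- q b) * E_(m-1)(S')^(-gamma) is completely
    monotone, and so are exp (- p x_i), their product and its mixtures.

    Signs are controlled by finite differences instead of derivatives: [cm f]
    says that all alternating differences of f with nonnegative steps are
    nonnegative. This is visibly stable under products, pointwise limits and
    integrals, without differentiation under the integral sign. For a smooth f
    the derivatives are limits of difference quotients, so [cm f] gives their
    signs ([cm_partials]). The smoothness of E_m^(-alpha) is independent of the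
    induction: the functions built from coordinates by sums, products and powers
    of positive functions are closed under partial derivatives. *)

Set Implicit Arguments.
Unset Strict Implicit.
Unset Printing Implicit Defensive.
Import Order.TTheory GRing.Theory Num.Theory.
Import numFieldNormedType.Exports.
Local Open Scope ring_scope.

(** * Elementary symmetric polynomials on a subset of the variables *)

Section ElementarySymmetric.
Variables (R : realType) (n : nat).
Implicit Types (S : {set 'I_n}) (x : 'rV[R]_n).

(** The variables are restricted to a subset [S] of the indices, not to a
    smaller type, so that deleting a variable stays inside 'rV[R]_n. *)
Definition elsym (m : nat) S x : R :=
  \sum_(h : {set 'I_n} | (h \subset S) && (#|h| == m)) \prod_(i in h) x 0 i.

Lemma elem_sym_elsym m x : elem_sym m x = elsym m [set: 'I_n]%SET x.
Proof. by rewrite elem_symE; apply: eq_bigl => h; rewrite finset.subsetT. Qed.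

Lemma elsym0 S x : elsym 0 S x = 1.
Proof.
rewrite /elsym (big_pred1 finset.set0) ?big_set0// => h.
rewrite /= cards_eq0 andbC.
by case: eqVneq => [->|//]; rewrite finset.sub0set.
Qed.

(** Multiplying by x_i turns the m-subsets of S \ i into the (m+1)-subsets of S
    that contain i; this is the source of the next two identities. *)
Lemma elsymD1_mul m S x i : i \in S ->
  x 0 i * elsym m (S :\ i)%SET x =
  \sum_(h : {set 'I_n} | [&& h \subset S, #|h| == m.+1 & i \in h])
     \prod_(j in h) x 0 j.
Proof.
move=> iS; rewrite /elsym mulr_sumr.
rewrite [RHS](reindex_onto (fun h => i |: h)%SET (fun h => h :\ i)%SET) /=; last first.
  by move=> h /and3P[_ _ ih]; rewrite finset.setD1K.
apply: eq_big => [h|h /andP[hS _]].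
  rewrite finset.setU11 andbT finset.subUset finset.sub1set iS /= cardsU1 subsetD1.
  case: (boolP (i \in h)) => ih /=.
    rewrite andbF; apply/esym/negbTE/negP => /andP[_ /eqP hi].
    by move: ih; rewrite -hi !inE eqxx.
  by rewrite finset.setU1K// eqxx add1n eqSS !andbT.
have ih : i \notin h by move: hS; rewrite subsetD1 => /andP[].
by rewrite big_setU1.
Qed.

Lemma elsym_recl m S x i : i \in S ->
  elsym m.+1 S x = x 0 i * elsym m (S :\ i)%SET x + elsym m.+1 (S :\ i)%SET x.
Proof.
move=> iS; rewrite elsymD1_mul// /elsym (bigID (fun h : {set 'I_n} => i \in h)) /=.
congr (_ + _); apply: eq_bigl => h; first by rewrite andbA.
by rewrite subsetD1 andbAC.
Qed.

(** Each (m+1)-subset of S is counted once for each of its elements. *)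
Lemma elsym_euler m S x :
  \sum_(i in S) x 0 i * elsym m (S :\ i)%SET x = m.+1%:R * elsym m.+1 S x.
Proof.
under eq_bigr => i iS do rewrite elsymD1_mul//.
rewrite (exchange_big_dep (fun h : {set 'I_n} => (h \subset S) && (#|h| == m.+1)))/=;
  last by move=> i h _ /and3P[-> ->].
rewrite /elsym mulr_sumr; apply: eq_bigr => h /andP[hS /eqP hm].
rewrite mulr_natl -hm -sumr_const; apply: eq_bigl => i.
by rewrite hS hm eqxx /=; case: (boolP (i \in h)) => ih;
  rewrite ?andbF// (fintype.subsetP hS).
Qed.

Lemma elsym_ge0 m S x : pos_orthant x -> 0 <= elsym m S x.
Proof. by move=> x0; apply: sumr_ge0 => h _; apply: prodr_ge0 => i _; exact/ltW. Qed.

Lemma elsym_gt0 m S x : (m <= #|S|)%N -> pos_orthant x -> 0 < elsym m S x.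
Proof.
elim: m S => [S _ _|m IH S mS x0]; first by rewrite elsym0.
have /card_gt0P[i iS] : (0 < #|S|)%N by exact: leq_trans mS.
rewrite (elsym_recl m x iS) ltr_pwDl ?elsym_ge0// mulr_gt0// IH//.
by move: mS; rewrite (cardsD1 i S) iS.
Qed.

Lemma elsym1 S x : elsym 1 S x = \sum_(i in S) x 0 i.
Proof.
have := elsym_euler 0 S x; rewrite mul1r => <-.
by apply: eq_bigr => i _; rewrite elsym0 mulr1.
Qed.

End ElementarySymmetric.

(** * Complete monotonicity by finite differences *)

Section DifferenceMonotone.
Variables (R : realType) (n : nat).
Implicit Types (f g : 'rV[R]_n -> R) (x h : 'rV[R]_n).

(** The steps [h] are vectors and may change from one difference to the next.
    Nonnegativity is required at every level, which makes the levels nested. *)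
Fixpoint diff_mono (k : nat) f : Prop :=
  if k is k'.+1 then
    (forall x, pos_orthant x -> 0 <= f x) /\
    forall h, (forall i, 0 <= h 0 i) -> diff_mono k' (fun x => f x - f (x + h))
  else forall x, pos_orthant x -> 0 <= f x.

Definition cm f := forall k, diff_mono k f.

Lemma pos_orthantD x h : pos_orthant x -> (forall i, 0 <= h 0 i) ->
  pos_orthant (x + h).
Proof. by move=> x0 h0 i; rewrite mxE ltr_wpDr. Qed.

Lemma diff_mono_ge0 k f x : diff_mono k f -> pos_orthant x -> 0 <= f x.
Proof. by case: k => [|k] /=; [|case]; auto. Qed.

Lemma eq_diff_mono k f g : (forall x, pos_orthant x -> f x = g x) ->
  diff_mono k f -> diff_mono k g.
Proof.
elim: k f g => [|k IH] f g fg /=; first by move=> f0 x x0; rewrite -fg//; exact: f0.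
move=> [f0 fk]; split=> [x x0|h h0]; first by rewrite -fg//; exact: f0.
apply: IH (fk h h0) => x x0.
by rewrite !fg//; exact: pos_orthantD.
Qed.

Lemma diff_monoW k f : diff_mono k.+1 f -> diff_mono k f.
Proof.
elim: k f => [|k IH] f; first by case.
by move=> [f0 fk]; split=> // h h0; exact/IH/fk.
Qed.

Lemma diff_mono_shift k f h : (forall i, 0 <= h 0 i) ->
  diff_mono k f -> diff_mono k (fun x => f (x + h)).
Proof.
elim: k f => [|k IH] f h0 /=; first by move=> f0 x x0; apply/f0/pos_orthantD.
move=> [f0 fk]; split=> [x x0|h' h'0]; first exact/f0/pos_orthantD.
apply: eq_diff_mono (IH _ h0 (fk _ h'0)) => x x0 /=.
by rewrite addrAC.
Qed.

Lemma diff_monoD k f g : diff_mono k f -> diff_mono k g ->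
  diff_mono k (fun x => f x + g x).
Proof.
elim: k f g => [|k IH] f g /=; first by move=> f0 g0 x x0; rewrite addr_ge0//; auto.
move=> [f0 fk] [g0 gk]; split=> [x x0|h h0]; first by rewrite addr_ge0//; auto.
by apply: eq_diff_mono (IH _ _ (fk _ h0) (gk _ h0)) => x x0 /=; ring.
Qed.

(** Leibniz rule for differences:
    fg - f'g' = (f - f') g + f' (g - g'), where ' is the shift by h. *)
Lemma diff_monoM k f g : diff_mono k f -> diff_mono k g ->
  diff_mono k (fun x => f x * g x).
Proof.
elim: k f g => [|k IH] f g; first by move=> f0 g0 x x0; rewrite mulr_ge0//; auto.
move=> fk1 gk1; have [f0 fk] := fk1; have [g0 gk] := gk1.
split=> [x x0|h h0]; first by rewrite mulr_ge0//; auto.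
have P := IH _ _ (fk _ h0) (diff_monoW gk1).
have Q := IH _ _ (diff_mono_shift h0 (diff_monoW fk1)) (gk _ h0).
by apply: eq_diff_mono (diff_monoD P Q) => x x0 /=; ring.
Qed.

Lemma cmM f g : cm f -> cm g -> cm (fun x => f x * g x).
Proof. by move=> fk gk k; apply: diff_monoM. Qed.

Lemma eq_cm f g : (forall x, pos_orthant x -> f x = g x) -> cm f -> cm g.
Proof. by move=> fg fk k; apply: eq_diff_mono fg (fk k). Qed.

Lemma cm_cst (c : R) : 0 <= c -> cm (fun=> c).
Proof.
move=> c0 k; elim: k c c0 => [|k IH] c c0 //=; split=> // h _.
by rewrite subrr; exact: IH.
Qed.

Lemma cmZ (c : R) f : 0 <= c -> cm f -> cm (fun x => c * f x).
Proof. by move=> c0; apply: cmM; exact: cm_cst. Qed.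

Lemma cm_prod (I : finType) (P : pred I) (F : I -> 'rV[R]_n -> R) :
  (forall i, P i -> cm (F i)) -> cm (fun x => \prod_(i | P i) F i x).
Proof.
move=> FP; suff H (s : seq I) : cm (fun x => \prod_(i <- s | P i) F i x) by exact: H.
elim: s => [|i s IH].
  by apply: (@eq_cm (fun=> 1)) (cm_cst ler01) => x _; rewrite big_nil.
case: (boolP (P i)) => Pi.
  by apply: eq_cm (cmM (FP i Pi) IH) => x _; rewrite big_cons Pi.
by apply: eq_cm IH => x _; rewrite big_cons (negbTE Pi).
Qed.

(** A difference of exp (- p x_i) is again a nonnegative multiple of it. *)
Lemma cm_expR_coord (i : 'I_n) (p : R) : 0 <= p -> cm (fun x => expR (- (p * x 0 i))).
Proof.
move=> p0 k; suff H (c : R) : 0 <= c -> diff_mono k (fun x => c * expR (- (p * x 0 i))).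
  by apply: eq_diff_mono (H 1 ler01) => x _; rewrite mul1r.
elim: k c => [|k IH] c c0; first by move=> x _; rewrite mulr_ge0 ?expR_ge0.
split=> [x _|h h0]; first by rewrite mulr_ge0 ?expR_ge0.
have e1 : expR (- (p * h 0 i)) <= 1.
  by rewrite -expR0 ler_expR oppr_le0 mulr_ge0.
apply: (@eq_diff_mono _ (fun x => (c * (1 - expR (- (p * h 0 i)))) * expR (- (p * x 0 i)))).
  by move=> x _; rewrite mxE (mulrDr p) opprD expRD; ring.
by apply: IH; rewrite mulr_ge0// subr_ge0.
Qed.

Lemma cm_cvg (F : nat -> 'rV[R]_n -> R) f :
  (forall j, cm (F j)) ->
  (forall x, pos_orthant x -> (fun j => F j x) @ \oo --> f x)%classic -> cm f.
Proof.
move=> FP Ff k; have {}FP j : diff_mono k (F j) by exact: FP.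
elim: k F f FP Ff => [|k IH] F f FP Ff.
  move=> x x0; have := Ff x x0 => /cvg_lim <- //.
  by apply: limr_ge; [apply/cvg_ex; exists (f x); exact: Ff|apply: nearW => j; exact: FP].
split=> [x x0|h h0].
  have := Ff x x0 => /cvg_lim <- //.
  apply: limr_ge; [by apply/cvg_ex; exists (f x); exact: Ff|apply: nearW => j].
  exact: (diff_mono_ge0 (FP j) x0).
apply: (IH (fun j x => F j x - F j (x + h))) => [j|x x0]; first by have [_] := FP j; exact.
by apply: cvgB; apply: Ff => //; exact: pos_orthantD.
Qed.

(** A difference of integrals is the integral of the differences. *)
Lemma cm_integral (F : R -> 'rV[R]_n -> R) :
  (forall u, cm (F u)) ->
  (forall x, pos_orthant x ->
    (@lebesgue_measure R).-integrable setT (EFin \o (F ^~ x))) ->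
  cm (fun x => \int[@lebesgue_measure R]_u F u x).
Proof.
move=> FP Fi k; have {}FP j : diff_mono k (F j) by exact: FP.
elim: k F FP Fi => [|k IH] F FP Fi.
  by move=> x x0; apply: Rintegral_ge0 => u _; exact: FP.
split=> [x x0|h h0].
  by apply: Rintegral_ge0 => u _; exact: (diff_mono_ge0 (FP u) x0).
apply: (@eq_diff_mono _ (fun x => \int[@lebesgue_measure R]_u (F u x - F u (x + h)))).
  by move=> x x0; rewrite RintegralB//; apply: Fi => //; exact: pos_orthantD.
apply: IH => [u|x x0]; first by have [_] := FP u; exact.
have := integrableB measurableT (Fi _ x0) (Fi _ (pos_orthantD x0 h0)).
by apply: eq_integrable.
Qed.

End DifferenceMonotone.

(** * Powers and Gaussians as mixtures of exponentials *)

Section Mixtures.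
Variable R : realType.
Local Notation mu := (@lebesgue_measure R).

(** The normal density of mean m and variance 1 / (2 c), up to a constant. *)
Lemma integral_gauss_scaled (c m : R) : 0 < c ->
  mu.-integrable setT (EFin \o (fun u => expR (- (c * (u - m) ^+ 2)))) /\
  \int[mu]_u expR (- (c * (u - m) ^+ 2)) = Num.sqrt pi * c `^ (- 2^-1).
Proof.
move=> c0; pose s : R := Num.sqrt ((c *+ 2)^-1).
have c20 : 0 < (c *+ 2)^-1 by rewrite invr_gt0 mulrn_wgt0.
have s0 : s != 0 by rewrite gt_eqF// sqrtr_gt0.
have s2 : s ^+ 2 *+ 2 = c^-1.
  rewrite sqr_sqrtr; last exact: ltW.
  by rewrite !mulr2n; field; rewrite gt_eqF//=; lra.
have E u : expR (- (c * (u - m) ^+ 2)) = Num.sqrt (pi / c) * normal_pdf m s u.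
  rewrite normal_pdfE// /normal_peak /normal_fun s2 invrK mulNr.
  have -> : s ^+ 2 * pi *+ 2 = pi / c by rewrite -mulrnAl s2 mulrC.
  rewrite [RHS]mulrA divff ?mul1r; last by rewrite gt_eqF// sqrtr_gt0 divr_gt0 ?pi_gt0.
  by rewrite (mulrC c).
have I := integrable_normal_pdf m s.
split.
  have := integrableZl measurableT (Num.sqrt (pi / c)) I.
  by apply: eq_integrable => // u _ /=; rewrite E EFinM.
under eq_Rintegral => u _ do rewrite E.
rewrite RintegralZl// /Rintegral integral_normal_pdf /= mulr1.
by rewrite sqrtrM ?pi_ge0// sqrtrV ?ltW// powRN powR12_sqrt// ltW.
Qed.

(** The exponent u^2 a + (r - u)^2 b, the energy of two edges in series, is
    minimal at u = r b / (a + b), with minimum r^2 a b / (a + b). *)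
Lemma integral_two_squares (a b r : R) : 0 < a -> 0 <= b ->
  mu.-integrable setT (EFin \o (fun u => expR (- (u ^+ 2 * a + (r - u) ^+ 2 * b)))) /\
  \int[mu]_u expR (- (u ^+ 2 * a + (r - u) ^+ 2 * b)) =
  Num.sqrt pi * (expR (- (r ^+ 2 * (a * b / (a + b)))) * (a + b) `^ (- 2^-1)).
Proof.
move=> a0 b0; have ab : 0 < a + b by rewrite ltr_wpDr.
have [I E] := integral_gauss_scaled (r * b / (a + b)) ab.
set k := expR (- (r ^+ 2 * (a * b / (a + b)))).
have C u : expR (- (u ^+ 2 * a + (r - u) ^+ 2 * b)) =
    k * expR (- ((a + b) * (u - r * b / (a + b)) ^+ 2)).
  by rewrite -expRD; congr expR; field; rewrite gt_eqF.
split.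
  have := integrableZl measurableT k I.
  by apply: eq_integrable => // u _ /=; rewrite C EFinM.
under eq_Rintegral => u _ do rewrite C.
by rewrite RintegralZl// E mulrCA.
Qed.

Lemma continuous_sqr_powR (q : R) : 1 <= q -> continuous (fun v : R => (v ^+ 2) `^ q).
Proof.
move=> q1 v; have [->|v0] := eqVneq v 0; last first.
  have v2 : 0 < v ^+ 2 by rewrite exprn_even_gt0.
  suff : continuous_at (v : R) (((@powR R) ^~ q) \o (fun v : R => v ^+ 2)) by exact.
  apply: continuous_comp; first exact: exprn_continuous.
  apply: differentiable_continuous; apply/derivable1_diffP.
  by have [] := is_derive1_powR q v2.
rewrite /continuous_at /= expr0n /= powR0; last by rewrite gt_eqF//; lra.
apply: (@squeeze_cvgr _ _ _ _ (cst 0) (fun v : R => v ^+ 2)).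
- near=> w; rewrite /= powR_ge0 /=.
  have w1 : `|w| <= 1 by near: w; exact: (@nbhs0_le _ R^o _ ltr01).
  have {}w1 : w ^+ 2 <= 1 by rewrite -real_normK ?num_real// expr_le1.
  have [->|w0] := eqVneq w 0; first by rewrite expr0n powR0// gt_eqF//; lra.
  by apply: ge1r_powR => //; rewrite w1 andbT exprn_even_gt0.
- exact: cvg_cst.
- by have := @exprn_continuous R 2 0; rewrite /continuous_at expr0n; exact.
Unshelve. all: by end_near.
Qed.

Lemma ge0_integral_scale (G : R -> R) (l : R) : 0 < l -> continuous G ->
  (forall v, 0 <= G v) ->
  (\int[mu]_v (G v)%:E = l%:E * \int[mu]_v (G (l * v))%:E)%E.
Proof.
move=> l0 cG G0; pose F (v : R) : R := l * v.
have F' : (F^`())%classic = cst l.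
  apply/funext => x; rewrite /F derive1E deriveM// derive_id derive_cst.
  by rewrite scaler0 addr0 /GRing.scale/= mulr1.
have cGF : continuous (G \o F).
  by move=> v; apply: continuous_comp; [apply: cvgM; [exact: cvg_cst|exact: cvg_id]|exact: cG].
have mGF : measurable_fun setT (EFin \o (G \o F)).
  by apply/measurable_EFinP; exact: continuous_measurable_fun.
have l0' : (0 <= l%:E)%E by rewrite lee_fin ltW.
rewrite -(ge0_integralZl mu measurableT mGF (fun x _ => G0 _) l0').
rewrite (@increasing_ge0_integration_by_substitutionT R F G) ?F'//.
- by apply: eq_integral => v _; rewrite -EFinM mulrC.
- by move=> x y xy; rewrite /F ltr_pM2l.
- by move=> x; exact: cvg_cst.
- exact: is_cvg_cst.
- exact: is_cvg_cst.
- exact: gt0_cvgMrNy.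
- exact: gt0_cvgMry.
Qed.

(** Homogeneity: replacing v by c^(1/(2q)) v pulls c out of the integral. The
    condition q >= 1 makes the integrand at most e times the Gaussian. *)
Lemma integral_expR_pow (q : R) : 1 <= q ->
  exists2 K : R, 0 < K & forall c, 0 < c ->
  mu.-integrable setT (EFin \o (fun v => expR (- (c * (v ^+ 2) `^ q)))) /\
  \int[mu]_v expR (- (c * (v ^+ 2) `^ q)) = K * c `^ (- (q *+ 2)^-1).
Proof.
move=> q1.
pose G (v : R) := expR (- ((v ^+ 2) `^ q)).
have cG : continuous G.
  move=> v; apply: (cvg_comp _ expR); last exact: continuous_expR.
  apply: cvgN; exact: continuous_sqr_powR.
have iG : mu.-integrable setT (EFin \o G).
  have := integrableZl measurableT (expR 1) (@integrableT_gauss R).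
  apply: le_integrable => //.
    by apply/measurable_EFinP; exact: continuous_measurable_fun.
  move=> v _; rewrite /= lee_fin /gauss_fun -expRD !ger0_norm ?expR_ge0//.
  rewrite ler_expR.
  have [v1|v1] := leP (v ^+ 2) 1.
    by have := powR_ge0 (v ^+ 2) q; lra.
  have := ler_powR (ltW v1) q1; rewrite powRr1 ?sqr_ge0//.
  by have := powR_ge0 (v ^+ 2) q; lra.
pose K := \int[mu]_v G v.
have S c : 0 < c ->
  (\int[mu]_v (expR (- (c * (v ^+ 2) `^ q)))%:E = (K * c `^ (- (q *+ 2)^-1))%:E)%E.
  move=> c0; pose l : R := c `^ ((q *+ 2)^-1).
  have l0 : 0 < l by exact: powR_gt0.
  have GF v : G (l * v) = expR (- (c * (v ^+ 2) `^ q)).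
    have e1 : (q *+ 2)^-1 * 2%:R * q = 1 by rewrite mulr2n; field; lra.
    have lq : (l ^+ 2) `^ q = c.
      rewrite -powR_mulrn; last exact: ltW.
      by rewrite /l -powRrM -powRrM mulrA e1 powRr1// ltW.
    by rewrite /G exprMn powRM ?sqr_ge0// lq.
  have EK : (\int[mu]_v (G v)%:E = K%:E)%E.
    by rewrite /K /Rintegral fineK//; apply: integrable_fin_num.
  have H := ge0_integral_scale l0 cG (fun v => expR_ge0 _).
  under eq_integral => v _ do rewrite -GF.
  by rewrite powRN mulrC EFinM -EK H muleA -EFinM mulVf ?gt_eqF// mul1e.
exists K.
  (* K is positive because the integrand is at least 1/e on [0, 1]. *)
  have H01 : ((expR (- 1))%:E <= \int[mu]_v (G v)%:E)%E.
    apply: (@le_trans _ _ (\int[mu]_(v in `[0%R, 1%R]%classic) (G v)%:E)%E).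
      rewrite -[leLHS]mule1 -[X in (_ * X)%E](_ : mu `[0%R, 1%R]%classic = 1%E); last first.
        by rewrite lebesgue_measure_itv/= lte01 oppr0 adde0.
      rewrite -integral_cst//; apply: ge0_le_integral => //.
      - by move=> v _; rewrite /= lee_fin expR_ge0.
      - apply/measurable_EFinP; apply: measurable_funTS.
        exact: continuous_measurable_fun.
      - move=> v; rewrite /= in_itv /= => /andP[v0 v1].
        rewrite lee_fin ler_expR lerN2.
        have [->|v0'] := eqVneq v 0.
          by rewrite expr0n powR0 ?ler01// gt_eqF//; lra.
        have v21 : v ^+ 2 <= 1 by rewrite expr_le1.
        apply: (le_trans _ v21); apply: ge1r_powR => //.
        by rewrite v21 andbT exprn_even_gt0.
    apply: ge0_subset_integral => //.
      by apply/measurable_EFinP; exact: continuous_measurable_fun.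
    by move=> v _; rewrite lee_fin expR_ge0.
  apply: (lt_le_trans (expR_gt0 (- 1))).
  by rewrite -lee_fin /K /Rintegral fineK//; apply: integrable_fin_num.
move=> c c0; split; last by rewrite /Rintegral S.
apply/integrableP; split.
  apply/measurable_EFinP; apply: continuous_measurable_fun => v.
  apply: (cvg_comp _ expR); last exact: continuous_expR.
  apply: cvgN; apply: cvgM; [exact: cvg_cst|exact: continuous_sqr_powR].
under eq_integral => v _ do rewrite /= ger0_norm ?expR_ge0//.
by rewrite S// ltry.
Qed.
End Mixtures.

(** * Mixtures of exponentials in two functions *)

Section ParallelSum.
Variables (R : realType) (n : nat) (a b : 'rV[R]_n -> R).
Hypothesis a_gt0 : forall x, pos_orthant x -> 0 < a x.
Hypothesis b_ge0 : forall x, pos_orthant x -> 0 <= b x.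
Local Notation mu := (@lebesgue_measure R).

(** [F] may be multiplied by any exponential exp (- p a - q b), hence by any
    positive mixture of them. For the ratios b used below, exp (- q b) alone need
    not be completely monotone; [F] compensates for it. *)
Definition mixable (F : 'rV[R]_n -> R) :=
  forall p q : R, 0 <= p -> 0 <= q ->
    cm (fun x => expR (- (p * a x + q * b x)) * F x).

Lemma mixable_cm F : mixable F -> cm F.
Proof.
move=> /(_ 0 0 (lexx _) (lexx _)); apply: eq_cm => x _.
by rewrite !mul0r addr0 oppr0 expR0 mul1r.
Qed.

(** The mixtures are indexed by a real parameter [u] with Lebesgue measure;
    the total weight [w] is divided out at the end. *)
Lemma mixable_integral (P Q : R -> R) (w : R) (F h : 'rV[R]_n -> R) :
  0 < w -> (forall u, 0 <= P u) -> (forall u, 0 <= Q u) ->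
  (forall x, pos_orthant x ->
    mu.-integrable setT (EFin \o (fun u => expR (- (P u * a x + Q u * b x)))) /\
    \int[mu]_u expR (- (P u * a x + Q u * b x)) = w * h x) ->
  mixable F -> mixable (fun x => h x * F x).
Proof.
move=> w0 P0 Q0 Ph mF p q p0 q0.
pose k x := expR (- (p * a x + q * b x)) * F x.
have E x u : expR (- ((p + P u) * a x + (q + Q u) * b x)) * F x =
    k x * expR (- (P u * a x + Q u * b x)).
  by rewrite /k mulrAC -expRD; congr (expR _ * _); ring.
have I x : pos_orthant x -> mu.-integrable setT
    (EFin \o (fun u => expR (- ((p + P u) * a x + (q + Q u) * b x)) * F x)).
  move=> x0; have := integrableZl measurableT (k x) (Ph x x0).1.
  by apply: eq_integrable => // u _ /=; rewrite E EFinM.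
have C := cm_integral
  (fun u => mF (p + P u) (q + Q u) (addr_ge0 p0 (P0 u)) (addr_ge0 q0 (Q0 u))) I.
have w10 : 0 <= w^-1 by rewrite invr_ge0 ltW.
apply: eq_cm (cmZ w10 C) => x x0.
under eq_Rintegral => u _ do rewrite E.
rewrite RintegralZl//; last exact: (Ph x x0).1.
rewrite (Ph x x0).2 /k; field.
by rewrite gt_eqF.
Qed.

Lemma mixable_parallel (r : R) F : mixable F ->
  mixable (fun x => expR (- (r ^+ 2 * (a x * b x / (a x + b x)))) *
                    (a x + b x) `^ (- 2^-1) * F x).
Proof.
apply: (@mixable_integral (fun u => u ^+ 2) (fun u => (r - u) ^+ 2) (Num.sqrt pi)).
- by rewrite sqrtr_gt0 pi_gt0.
- by move=> u; exact: sqr_ge0.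
- by move=> u; exact: sqr_ge0.
- by move=> x x0; apply: integral_two_squares; [exact: a_gt0|exact: b_ge0].
Qed.

(** Exponents g < 1/2 come from [integral_expR_pow] with q = 1 / (2 g); larger
    ones are reduced by steps of 1/2, taken from [mixable_parallel] at r = 0. *)
Lemma mixable_powR (g : R) F : 0 <= g -> mixable F ->
  mixable (fun x => (a x + b x) `^ (- g) * F x).
Proof.
have [N] : exists N : nat, g <= N%:R / 2.
  have [N gN] : exists N : nat, g * 2 <= N%:R.
    have [g0|g0] := leP 0 g; last by exists 0%N; rewrite pmulr_lle0// ltW.
    exists (Num.Def.archi_bound (g * 2)); apply/ltW/archi_boundP; rewrite mulr_ge0//.
  by exists N; rewrite ler_pdivlMr.
elim: N g F => [|N IH] g F gN g0 mF.
  have -> : g = 0 by apply/eqP; rewrite eq_le g0 andbT; rewrite mul0r in gN.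
  move=> p q p0 q0; apply: eq_cm (mF p q p0 q0) => x x0.
  by rewrite oppr0 powRr0 mul1r.
have [g12|g12] := leP g (2^-1).
  have [->|g00] := eqVneq g 0.
    move=> p q p0 q0; apply: eq_cm (mF p q p0 q0) => x x0.
    by rewrite oppr0 powRr0 mul1r.
  have {}g0 : 0 < g by rewrite lt_neqAle eq_sym g00.
  pose s := (g *+ 2)^-1.
  have s1 : 1 <= s.
    by rewrite /s -[leLHS]invr1 lef_pV2 ?posrE ?mulr2n; lra.
  have [K K0 KE] := integral_expR_pow s1.
  apply: (@mixable_integral (fun u => (u ^+ 2) `^ s) (fun u => (u ^+ 2) `^ s) K) => //.
  - by move=> u; exact: powR_ge0.
  - by move=> u; exact: powR_ge0.
  move=> x x0; have c0 : 0 < a x + b x by rewrite ltr_wpDr ?b_ge0 ?a_gt0.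
  have [I E] := KE _ c0.
  have D u : (u ^+ 2) `^ s * a x + (u ^+ 2) `^ s * b x = (a x + b x) * (u ^+ 2) `^ s.
    by rewrite -mulrDr mulrC.
  split; first by apply: eq_integrable I => // u _ /=; rewrite D.
  under eq_Rintegral => u _ do rewrite D.
  rewrite E /s; congr (_ * _ `^ (- _)).
  by rewrite !mulr2n; field; rewrite !gt_eqF//; lra.
have H : mixable (fun x => (a x + b x) `^ (- (g - 2^-1)) * F x).
  apply: IH => //; last by lra.
  by move: gN; rewrite -addn1 natrD mulrDl mul1r; lra.
have := mixable_parallel 0 H => {}H p q p0 q0.
apply: eq_cm (H p q p0 q0) => x x0.
have c0 : 0 < a x + b x by rewrite ltr_wpDr ?b_ge0 ?a_gt0.
rewrite expr0n /= mul0r oppr0 expR0 mul1r; congr (_ * _).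
rewrite mulrA -powRD; last by rewrite (gt_eqF c0) implybT.
by congr (_ `^ _ * _); lra.
Qed.

Lemma cm_parallel (t beta : R) F : 0 <= t -> 2^-1 <= beta -> mixable F ->
  cm (fun x => expR (- (t * (a x * b x / (a x + b x)))) *
               (a x + b x) `^ (- beta) * F x).
Proof.
move=> t0 beta12 mF.
have g0 : 0 <= beta - 2^-1 by lra.
have := mixable_cm (mixable_parallel (Num.sqrt t) (mixable_powR g0 mF)).
apply: eq_cm => x x0.
have c0 : 0 < a x + b x by rewrite ltr_wpDr ?b_ge0 ?a_gt0.
rewrite sqr_sqrtr// -!mulrA; congr (_ * _).
rewrite mulrA -powRD; last by rewrite (gt_eqF c0) implybT.
by congr (_ `^ _ * _); lra.
Qed.

End ParallelSum.

(** * Induction on the degree *)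

Section Induction.
Variables (R : realType) (n : nat).

(** The bound n^m is divided by |S| <= n at each step, so that the exponent
    beta / |S| left to each factor satisfies the previous bound, and is >= 1/2. *)
Lemma cm_elsym_ratio (m : nat) (S : {set 'I_n}) (beta t : R) :
  (m <= #|S|)%N -> (n ^ m)%:R <= beta -> 0 <= t ->
  cm (fun x => expR (- (t * (elsym m.+1 S x / elsym m S x))) *
               elsym m S x `^ (- beta)).
Proof.
elim: m S beta t => [|m IH] S beta t mS hb t0.
  apply: (@eq_cm _ _ (fun x => \prod_(i in S) expR (- (t * x 0 i)))).
    move=> x x0; rewrite elsym0 powR1 mulr1 divr1 elsym1 -expR_sum.
    by rewrite mulr_sumr -sumrN.
  by apply: cm_prod => i iS; exact: cm_expR_coord.
have S0 : (0 < #|S|)%N by exact: leq_trans mS.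
have n0 : (0 < n)%N by rewrite (leq_trans S0)// -[X in (_ <= X)%N]card_ord max_card.
pose gam := beta / #|S|%:R; pose s := t / m.+2%:R.
have SR : 0 < #|S|%:R :> R by rewrite ltr0n.
have b0 : 0 <= beta by rewrite (le_trans _ hb).
have hg : (n ^ m)%:R <= gam.
  rewrite /gam ler_pdivlMr// (le_trans _ hb)// -natrM ler_nat expnS mulnC.
  by rewrite leq_mul2r -[X in (_ <= X)%N]card_ord max_card orbT.
have g12 : 2^-1 <= gam.
  apply: le_trans hg; apply: (@le_trans _ _ 1); first lra.
  by rewrite ler1n expn_gt0 n0.
have s0 : 0 <= s by rewrite divr_ge0.
(* The factor of i is [cm_parallel] for a = x_i and b = E_m(S \ i) / E_(m-1)(S \ i). *)
have step i : i \in S -> cm (fun x =>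
    expR (- (s * (x 0 i * elsym m.+1 (S :\ i)%SET x / elsym m.+1 S x))) *
    elsym m.+1 S x `^ (- gam)).
  move=> iS; have mT : (m <= #|(S :\ i)%SET|)%N.
    by move: mS; rewrite (cardsD1 i S) iS.
  pose b (x : 'rV[R]_n) : R := elsym m.+1 (S :\ i)%SET x / elsym m (S :\ i)%SET x.
  have b_ge0 x : pos_orthant x -> 0 <= b x.
    by move=> x0; rewrite divr_ge0 ?elsym_ge0.
  have mF : mixable (fun x => x 0 i) b (fun x => elsym m (S :\ i)%SET x `^ (- gam)).
    move=> p q p0 q0.
    apply: eq_cm (cmM (cm_expR_coord i p0) (IH (S :\ i)%SET gam q mT hg q0)) => x x0.
    by rewrite mulrA -expRD -opprD.
  apply: eq_cm (cm_parallel (fun x (x0 : pos_orthant x) => x0 i) b_ge0 s0 g12 mF) => x x0.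
  have e0 : 0 < elsym m (S :\ i)%SET x by exact: elsym_gt0.
  have f0 : 0 < elsym m.+1 S x by exact: elsym_gt0.
  have Eb : x 0 i + b x = elsym m.+1 S x / elsym m (S :\ i)%SET x.
    by rewrite /b (elsym_recl m x iS); field; rewrite gt_eqF.
  rewrite -mulrA -powRM ?ltW//; last by rewrite Eb divr_gt0.
  rewrite Eb divfK ?gt_eqF//; congr (expR (- (_ * _)) * _).
  by rewrite /b; field; rewrite !gt_eqF.
apply: eq_cm (cm_prod step) => x x0.
have f0 : 0 < elsym m.+1 S x by exact: elsym_gt0.
rewrite big_split /= -expR_sum; congr (expR _ * _).
  rewrite sumrN -mulr_sumr -mulr_suml elsym_euler /s; congr (- _).
  by field; rewrite ?gt_eqF//= ltr_wpDl.
rewrite prodr_const -powR_mulrn ?powR_ge0// -powRrM; congr (_ `^ _).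
by rewrite /gam; field; rewrite gt_eqF.
Qed.

Lemma cm_elem_sym_powR (m : nat) (alpha : R) :
  (m <= n)%N -> (n ^ m)%:R <= alpha ->
  cm (fun x : 'rV[R]_n => elem_sym m x `^ (- alpha)).
Proof.
move=> mn ha; have mS : (m <= #|[set: 'I_n]%SET|)%N by rewrite cardsT card_ord.
apply: eq_cm (cm_elsym_ratio mS ha (lexx 0)) => x _.
by rewrite mul0r oppr0 expR0 mul1r -elem_sym_elsym.
Qed.

End Induction.

(** * Smoothness and signs of the partial derivatives *)

Section Smoothness.
Variables (R : realType) (n : nat).
Implicit Types (f g : 'rV[R]_n -> R) (x v : 'rV[R]_n).

(** A class of functions closed under partial derivatives on the positive
    orthant: with it, smoothness needs no formula for the iterated derivatives. *)
Inductive smooth_expr : ('rV[R]_n -> R) -> Prop :=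
| SmoothCst c : smooth_expr (fun=> c)
| SmoothCoord i : smooth_expr (fun x => x 0 i)
| SmoothAdd f g : smooth_expr f -> smooth_expr g -> smooth_expr (fun x => f x + g x)
| SmoothMul f g : smooth_expr f -> smooth_expr g -> smooth_expr (fun x => f x * g x)
| SmoothPow f r : (forall x, pos_orthant x -> 0 < f x) -> smooth_expr f ->
    smooth_expr (fun x => f x `^ r).

Lemma smooth_expr_sum (I : Type) (s : seq I) (P : pred I) (F : I -> 'rV[R]_n -> R) :
  (forall i, smooth_expr (F i)) -> smooth_expr (fun x => \sum_(i <- s | P i) F i x).
Proof.
move=> sF; elim: s => [|i s IH].
  by under eq_fun do rewrite big_nil; exact: SmoothCst.
under eq_fun do rewrite big_cons; case: (P i) => //; exact: SmoothAdd.
Qed.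

Lemma smooth_expr_prod (I : Type) (s : seq I) (P : pred I) (F : I -> 'rV[R]_n -> R) :
  (forall i, smooth_expr (F i)) -> smooth_expr (fun x => \prod_(i <- s | P i) F i x).
Proof.
move=> sF; elim: s => [|i s IH].
  by under eq_fun do rewrite big_nil; exact: SmoothCst.
under eq_fun do rewrite big_cons; case: (P i) => //; exact: SmoothMul.
Qed.

Lemma smooth_expr_continuous f x : smooth_expr f -> pos_orthant x ->
  {for x, continuous f}.
Proof.
move=> sf x0; elim: sf => [c|i|g h _ cg _ ch|g h _ cg _ ch|g r g0 _ cg].
- exact: cst_continuous.
- exact: coord_continuous.
- exact: (@continuousD _ _ _ g h).
- exact: (@continuousM _ _ g h).
- apply: (@continuous_comp _ _ _ g (@powR R ^~ r)) => //.
  apply: differentiable_continuous; apply/derivable1_diffP.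
  by have [] := is_derive1_powR r (g0 _ x0).
Qed.

(** A derivative along v is the derivative at 0 of a function of one variable,
    to which the chain rule in one variable applies. *)
Lemma is_derive_line f x v d :
  is_derive (0 : R) 1 (fun h : R => f (h *: v + x)) d <-> is_derive x v f d.
Proof.
have E : derive (fun h : R => f (h *: v + x)) 0 1 = derive f x v.
  rewrite /derive; set g1 := fun h => h^-1 *: _; set g2 := fun h => h^-1 *: _.
  suff -> : g1 = g2 by [].
  by apply/funext => h; rewrite /g1 /g2 /= addr0 scale0r add0r [_%:A]mulr1.
have [D1 D2] := @derivable1P R _ _ f x v.
by split=> -[H1 H2]; split; rewrite -?H2 ?E; auto.
Qed.

Lemma is_derive_powR f x v d (r : R) : 0 < f x -> is_derive x v f d ->
  is_derive x v (fun y => f y `^ r) (r * f x `^ (r - 1) * d).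
Proof.
move=> fx0 /is_derive_line [df fd]; apply/is_derive_line.
set F := fun h : R => f (h *: v + x) in df fd *.
have F0 : F 0 = f x by rewrite /F scale0r add0r.
have dp : is_derive (F 0) 1 (@powR R ^~ r) (r * F 0 `^ (r - 1)).
  by apply: is_derive1_powR; rewrite F0.
have [dP pd] := dp.
split.
  apply/derivable1_diffP; apply: (@differentiable_comp _ _ _ _ F (@powR R ^~ r));
    exact/derivable1_diffP.
have := derive1_comp df dP; rewrite !derive1E => ->.
by rewrite pd fd F0.
Qed.

Lemma smooth_expr_derive f (i : 'I_n) : smooth_expr f ->
  exists2 g, smooth_expr g &
    forall x, pos_orthant x -> is_derive x (delta_mx 0 i) f (g x).
Proof.
elim=> [c|j|f1 f2 s1 [g1 sg1 d1] s2 [g2 sg2 d2]|f1 f2 s1 [g1 sg1 d1] s2 [g2 sg2 d2]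
  |f1 r f0 s1 [g1 sg1 d1]].
- by exists (fun=> 0); [exact: SmoothCst|move=> x _; exact: is_derive_cst].
- exists (fun=> (delta_mx 0 i : 'rV[R]_n) 0 j); first exact: SmoothCst.
  move=> x _; apply/is_derive_line.
  have -> : (fun h : R => (h *: (delta_mx 0 i : 'rV[R]_n) + x) 0 j) =
      (fun h : R => h * (delta_mx 0 i : 'rV[R]_n) 0 j) + cst (x 0 j).
    by apply/funext => h; rewrite !mxE.
  set k := _ 0 j.
  have := is_deriveD (is_deriveZ k (is_derive_id (0 : R) (1 : R)))
    (is_derive_cst (x 0 j) (0 : R) (1 : R)).
  rewrite addr0 [_%:A]mulr1; congr is_derive; apply/funext => h.
  by congr (_ + _); rewrite mulrC.
- exists (fun x => g1 x + g2 x); first exact: SmoothAdd.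
  by move=> x x0; exact: is_deriveD (d1 x x0) (d2 x x0).
- exists (fun x => f1 x * g2 x + f2 x * g1 x).
    by apply: SmoothAdd; exact: SmoothMul.
  by move=> x x0; exact: is_deriveM (d1 x x0) (d2 x x0).
- exists (fun x => r * f1 x `^ (r - 1) * g1 x).
    by apply: SmoothMul => //; apply: SmoothMul; [exact: SmoothCst|exact: SmoothPow].
  by move=> x x0; apply: is_derive_powR (d1 x x0); exact: f0.
Qed.

Lemma near_pos_orthant x : pos_orthant x -> \forall y \near x, pos_orthant y.
Proof.
move=> x0; have H (i : 'I_n) : nbhs x (fun y : 'rV[R]_n => 0 < y 0 i).
  exact: (@coord_continuous R 1 n 0 i x (fun z => 0 < z) (lt_nbhsr (x0 i))).
exact: (filter_forall _ H).
Qed.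

(** The class only describes the partial derivatives on the orthant; since it is
    open, that is enough to differentiate again. *)
Lemma smooth_expr_partials f (s : seq 'I_n) : smooth_expr f ->
  exists2 g, smooth_expr g & forall x, pos_orthant x -> partials s f x = g x.
Proof.
move=> sf; elim: s => [|i s [g sg fg]]; first by exists f.
have [h sh gh] := smooth_expr_derive i sg; exists h => // x x0 /=.
have [_ <-] := gh x x0.
apply: near_eq_derive; near=> y; apply: fg; near: y.
exact: near_pos_orthant.
Unshelve. all: by end_near. Qed.

Lemma smooth_expr_smooth_on f : smooth_expr f -> smooth_on (@pos_orthant R n) f.
Proof.
move=> sf s x x0; have [g sg fg] := smooth_expr_partials s sf.
have nfg : \forall y \near x, g y = partials s f y.
  near=> y; apply/esym/fg; near: y; exact: near_pos_orthant.
split.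
  rewrite /prop_for /continuous_at fg//; apply: cvg_trans (smooth_expr_continuous sg x0).
  exact: near_eq_cvg nfg.
move=> i; have [h sh gh] := smooth_expr_derive i sg.
by have [] := near_eq_is_derive nfg (gh x x0).
Unshelve. all: by end_near. Qed.

Lemma smooth_elem_sym_powR (m : nat) (r : R) : (m <= n)%N ->
  smooth_on (@pos_orthant R n) (fun x => elem_sym m x `^ r).
Proof.
move=> mn; apply: smooth_expr_smooth_on; apply: SmoothPow.
  by move=> x x0; rewrite elem_sym_elsym elsym_gt0// cardsT card_ord.
rewrite (funext (@elem_symE R m n)).
by apply: smooth_expr_sum => h; apply: smooth_expr_prod => i; exact: SmoothCoord.
Qed.

(** Minus a partial derivative is the limit of (G x - G (x + h e_i)) / h for
    h = 1 / (j + 1), and these quotients inherit monotonicity from G. *)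
Lemma cm_partials f (s : seq 'I_n) : cm f -> smooth_on (@pos_orthant R n) f ->
  cm (fun x => (-1) ^+ size s * partials s f x).
Proof.
move=> cf sf; elim: s => [|i s IH].
  by apply: eq_cm cf => x _; rewrite mul1r.
pose e j : 'rV[R]_n := (harmonic j : R) *: delta_mx 0 i.
have e0 j k : 0 <= e j 0 k by rewrite !mxE mulr_ge0 ?ler0n ?harmonic_ge0.
pose G x := (-1) ^+ size s * partials s f x.
apply: (@cm_cvg _ _ (fun j x => (harmonic j : R)^-1 * (G x - G (x + e j)))).
  move=> j; apply: cmZ; first by rewrite invr_ge0 harmonic_ge0.
  by move=> k; have [_] := IH k.+1; apply.
move=> x x0; have [_ /(_ i)] := sf s x x0 => /= D.
have {D} : ((fun h : R =>
     h^-1 *: (partials s f (h *: delta_mx 0 i + x) - partials s f x)) @ 0^' -->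
   'D_(delta_mx 0 i) (partials s f) x)%classic by [].
have H0 : ((fun j => harmonic j : R) @ \oo --> 0^')%classic.
  move=> P P0; have hP : \forall j \near \oo%classic, (harmonic j : R) != 0 -> P (harmonic j).
    exact: (@cvg_harmonic R _ P0).
  suff : \forall j \near \oo%classic, P (harmonic j) by [].
  by apply: filterS hP => j; apply; rewrite gt_eqF// harmonic_gt0.
move=> /(cvg_comp _ _ H0) D.
have -> : (fun j => (harmonic j : R)^-1 * (G x - G (x + e j))) =
    (fun j => - (-1) ^+ size s * ((harmonic j : R)^-1 *:
      (partials s f (harmonic j *: delta_mx 0 i + x) - partials s f x))).
  apply/funext => j; rewrite /G /e (addrC x) /GRing.scale /=; ring.
by rewrite exprS mulN1r; apply: cvgM; [exact: cvg_cst|exact: D].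
Qed.

End Smoothness.

Theorem theorem6p4 (R : realType) (m n : nat) (hm : (1 <= m)%N)
    (hmn : (m <= n)%N) :
  exists alpha' : R, 0 < alpha' /\
    forall alpha : R, alpha' <= alpha ->
      completely_monotone (fun x : 'rV[R]_n => elem_sym m x `^ (- alpha)).
Proof.
exists (n ^ m)%:R; split; first by rewrite ltr0n expn_gt0 (leq_trans hm).
move=> alpha ha; have sm := smooth_elem_sym_powR (- alpha) hmn.
split=> // s x _ x0.
exact: (cm_partials s (cm_elem_sym_powR hmn ha) sm 0%N x x0).
Qed.
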